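(* Let $q$ be an odd prime power, and let $n\ge 1$ be an integer coprime to $q$. Assume that the factorization of $x^n+1$ into irreducible polynomials over $\mathbb{F}_q$ is of the form $$x^n+1=\alpha\prod_{i=1}^s g_i(x)\prod_{j=1}^t h_j(x)h_j^*(x),$$ with $\alpha\in\mathbb{F}_q^*$, each $g_i$ a self-reciprocal polynomial of degree $2d_i$, and each $h_j$ of degree $e_j$, where $*$ denotes reciprocation; if $n$ is odd, let $g_1=x+1$ (so that in that case $g_i$ has degree $2d_i$ for $i\ge 2$). Let $\eta$ be the quadratic character of $\mathbb{F}_q$, and let $R=\mathbb{F}_q[x]/\langle x^n+1\rangle$. Then the number of LCD index-3 negacirculant codes over $\mathbb{F}_q$ of length $3n$ that are one-generator of the form $\langle [1,a,b]\rangle\subset R^3$ with $a,b\in R$ is $$(q^2-q+\eta(-1))\prod_{i=2}^s\left[q^{4d_i}-(q^{d_i}+1)(q^{2d_i}-q^{d_i})\right]\prod_{j=1}^t\left(q^{4e_j}-q^{3e_j}+q^{e_j}\right)$$ if $n$ is odd, and $$\prod_{i=1}^s\left[q^{4d_i}-(q^{d_i}+1)(q^{2d_i}-q^{d_i})\right]\prod_{j=1}^t\left(q^{4e_j}-q^{3e_j}+q^{e_j}\right)$$ if $n$ is even.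
   Context: The negashift maps $(x_0,\dots,x_{n-1})\in\mathbb{F}_q^n$ to $(-x_{n-1},x_0,\dots,x_{n-2})$. An $n\times n$ matrix over $\mathbb{F}_q$ is negacirculant if its rows are obtained by successive negashifts from its first row. An index-3 negacirculant (three-negacirculant) code is a $[3n,n]$ linear code over $\mathbb{F}_q$ with generator matrix $(I,A,B)$, with $I$ the identity matrix of order $n$ and $A,B$ negacirculant matrices of order $n$; equivalently, identifying $\mathbb{F}_q^n$ with $R=\mathbb{F}_q[x]/\langle x^n+1\rangle$ via coefficients, it is the $R$-submodule $\langle[1,a,b]\rangle$ of $R^3$ generated by $(1,a,b)$ for some $a,b\in R$. A linear code $\mathcal{C}\subset\mathbb{F}_q^N$ is LCD (linear complementary-dual) if $\mathcal{C}\cap\mathcal{C}^\perp=\{0\}$, with $\mathcal{C}^\perp$ the Euclidean dual. The reciprocal of a polynomial $f$ is $f^*(x)=x^{\deg f}f(1/x)$, and $f$ is self-reciprocal if $f^*$ is a nonzero scalar multiple of $f$. The quadratic character $\eta$ of $\mathbb{F}_q$ satisfies $\eta(x)=1$ if $x$ is a nonzero square in $\mathbb{F}_q$ and $\eta(x)=-1$ if $x$ is a non-square. *)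

(* Defs.v *)
From mathcomp Require Export all_boot all_order all_algebra.
Set Implicit Arguments.
Unset Strict Implicit.
Unset Printing Implicit Defensive.
Import GRing.Theory.
Local Open Scope ring_scope.

(* f^*(x) = x^(deg f) f(1/x): the coefficients in reverse order. *)
Definition reciprocal (F : fieldType) (f : {poly F}) : {poly F} :=
  \poly_(i < size f) f`_((size f).-1 - i).

Definition self_reciprocal (F : fieldType) (f : {poly F}) : Prop :=
  exists2 c : F, c != 0 & reciprocal f = c *: f.

Definition quad_char (F : finFieldType) (x : F) : int :=
  if x == 0 then 0 else if [exists y : F, y ^+ 2 == x] then 1 else -1.

Section Codes.

Variables (F : finFieldType) (N : nat).

(* A linear code is represented by the set of its codewords. *)
Definition euclidean_dual (C : {set 'rV[F]_N}) : {set 'rV[F]_N} :=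
  [set v | [forall c in C, v *m c^T == 0]].

Definition LCD (C : {set 'rV[F]_N}) : bool :=
  C :&: euclidean_dual C == [set 0].

Definition code_of (k : nat) (G : 'M[F]_(k, N)) : {set 'rV[F]_N} :=
  [set v | (v <= G)%MS].

End Codes.

Section Negacirculant.

Variables (F : finFieldType) (n : nat).

(* [ord_pred] is cyclic: it sends 0 to n - 1. *)
Definition negashift (x : 'rV[F]_n) : 'rV[F]_n :=
  \row_j (if j == 0%N :> nat then - x 0 (ord_pred j) else x 0 (ord_pred j)).

Definition negacirculant (A : 'M[F]_n) : bool :=
  [exists a : 'rV[F]_n, A == \matrix_(i < n) iter i negashift a].

Definition index3_negacirculant (C : {set 'rV[F]_(n + (n + n))}) : bool :=
  [exists A : 'M[F]_n, exists B : 'M[F]_n,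
    [&& negacirculant A, negacirculant B
      & C == code_of (row_mx 1%:M (row_mx A B))]].

(* The quotient {poly %/ p} is F[x]/<p> only when p is monic and nonconstant,
   which holds here as soon as 0 < n. *)
Local Notation R := {poly %/ ('X^n + 1 : {poly F})}.

Definition negaring_coefs (a : R) : 'rV[F]_n :=
  poly_rV (a : {poly _}).

Definition cyclic_submodule (v : 'rV[R]_3) : {set 'rV[R]_3} :=
  [set r *: v | r : R].

Definition negaring3_coefs (u : 'rV[R]_3) : 'rV[F]_(n + (n + n)) :=
  row_mx (negaring_coefs (u 0 0))
    (row_mx (negaring_coefs (u 0 1)) (negaring_coefs (u 0 2%:R))).

Definition one_generator_code (a b : R) : {set 'rV[F]_(n + (n + n))} :=
  negaring3_coefs @: cyclic_submodule (\row_(i < 3) [:: 1; a; b]`_i).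

Definition one_generator (C : {set 'rV[F]_(n + (n + n))}) : bool :=
  [exists a : R, exists b : R, C == one_generator_code a b].

End Negacirculant.

(* Main.v *)
(** Write [M] for [X^n + 1] and [a^bar] for the image of [a] under [x |-> 1/x],
    an involution of [R = F[x]/<M>]. The Euclidean product of two words of
    [F^n] is the constant coefficient of [a * b^bar] modulo [M], so the codeword
    [r (1, a, b)] is orthogonal to the code [<[1, a, b]>] exactly when [M]
    divides [r (1 + a a^bar + b b^bar)]: the code is LCD iff
    [1 + a a^bar + b b^bar] is a unit of [R]. By the Chinese remainder theorem
    the pairs [(a, b)] with this property are counted factor by factor.
    - On [F[x]/<g_i>] the bar is a nontrivial involution of a field of order
      [q^(2 d_i)]; by Hilbert 90 its norm takes each nonzero fixed value
      [q^(d_i) + 1] times.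
    - On [F[x]/<h_j h_j^*>] the bar exchanges the two factors, so the condition
      reads [1 + x1 x2 + y1 y2 <> 0] over the field of order [q^(e_j)].
    - On [F[x]/<x + 1>] the bar is the identity, which leaves the conic
      [a^2 + b^2 = -1] over [F]: it is a hyperbola [u v = -1] when [-1] is a
      square, and a norm equation in [F[x]/<x^2 + 1>] otherwise. *)
From HB Require Import structures.
Require Import Defs.
From mathcomp Require Import all_field ring zify.
Set Implicit Arguments.
Unset Strict Implicit.
Unset Printing Implicit Defensive.
Import GRing.Theory.
Local Open Scope ring_scope.

(** * Counting norms in a finite field with an involution *)

Lemma card_fibers (T U : finType) (f : T -> U) (A : {set T}) (B : {set U}) c :
  {in A, forall x, f x \in B} ->
  {in B, forall y, #|[set x in A | f x == y]| = c} -> #|A| = (#|B| * c)%N.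
Proof.
move=> fAB fib; rewrite -sum1_card (partition_big f (mem B)) //=.
rewrite -sum_nat_const; apply: eq_bigr => y yB.
by rewrite -(fib y yB) -sum1_card; apply: eq_bigl => x; rewrite !inE.
Qed.

Lemma card_dep_pairs (T U : finType) (P : T -> U -> bool) :
  #|[set u : T * U | P u.1 u.2]| = (\sum_x #|[set y | P x y]|)%N.
Proof.
rewrite -sum1dep_card -(pair_big_dep xpredT P (fun _ _ => 1%N)) /=.
by apply: eq_bigr => x _; rewrite sum1dep_card.
Qed.

Section NormCount.

Variables (K : finFieldType) (sigma : {rmorphism K -> K}) (Q : nat).
Hypothesis sigmaK : involutive sigma.
Hypothesis sigma_nontrivial : exists z, sigma z != z.
Hypothesis two_neq0 : (2%:R : K) != 0.
Hypothesis cardK : #|K| = (Q ^ 2)%N.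

Let K0 : {set K} := [set x | sigma x == x].
Let U : {set K} := [set x | x * sigma x == 1].

(** Since 2 is invertible, every element splits uniquely into a fixed part and [w] times a fixed
    part, where [sigma w = - w]; hence [K] is in bijection with [K0 * K0]. *)
Lemma card_fixed_field : #|K0| = Q.
Proof.
have [w w0 sw] : exists2 w, w != 0 & sigma w = - w.
  have [z z_moved] := sigma_nontrivial; exists (z - sigma z).
    by rewrite subr_eq0 eq_sym.
  by rewrite rmorphB sigmaK opprB.
have s2 : sigma 2%:R = 2%:R by rewrite rmorph_nat.
suff : (#|K0| * #|K0| = Q ^ 2)%N by move/eqP; rewrite mulnn eqn_exp2r // => /eqP.
rewrite -cardsX -cardK.
rewrite -(card_in_imset (f := fun u => u.1 + w * u.2)); last first.
  move=> [x y] [x' y'] /=; rewrite !inE /= => /andP[/eqP sx /eqP sy].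
  case/andP=> [/eqP sx' /eqP sy'] E.
  have := congr1 sigma E; rewrite !rmorphD !rmorphM sw sx sy sx' sy' => E'.
  have ex : x = x'.
    apply: (mulfI two_neq0).
    have -> : 2%:R * x = (x + w * y) + (x + - w * y) by ring.
    by rewrite E E'; ring.
  by move: E; rewrite ex => /addrI /(mulfI w0) ->.
rewrite -cardsT; congr #|pred_of_set _|; apply/setP => x; rewrite !inE.
apply/imsetP; exists ((x + sigma x) / 2%:R, (x - sigma x) / (2%:R * w)) => /=.
  rewrite !inE /= !(rmorphM, fmorphV) s2 sw rmorphD rmorphB !sigmaK.
  apply/andP; split; first by rewrite [sigma x + x]addrC.
  by apply/eqP; field; rewrite oppr_eq0 w0 /= andbT.
by field; rewrite w0 ?andbT.
Qed.

Let Q_gt1 : (1 < Q)%N.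
Proof.
have := finNzRing_gt1 K; rewrite cardK.
by case: (Q) => [|[]].
Qed.

Let card_unit : #|[set~ (0 : K)]| = (Q ^ 2 - 1)%N.
Proof. by rewrite cardsC1 cardK subn1. Qed.

Let card_fixed_star : #|K0 :\ 0| = (Q - 1)%N.
Proof.
by rewrite -card_fixed_field (cardsD1 0 K0) inE rmorph0 eqxx add1n subn1.
Qed.

(** The map [b |-> b / sigma b] sends the nonzero elements onto [U], and each fibre is a coset of
    the nonzero fixed elements, so [#|U|] is [(Q ^ 2 - 1) / (Q - 1)]. *)
Lemma card_norm1 : #|U| = Q.+1.
Proof.
have fib : #|[set~ (0 : K)]| = (#|U| * (Q - 1))%N.
  apply: (card_fibers (f := fun b => b / sigma b)) => [b | u].
    rewrite !inE => b0; have sb0 : sigma b != 0 by rewrite fmorph_eq0.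
    by rewrite rmorphM fmorphV sigmaK; apply/eqP; field; rewrite b0.
  rewrite inE => /eqP Nu.
  (* Hilbert 90: [c + u * sigma c] is a preimage of [u] unless it vanishes. *)
  have [b b0 su] : exists2 b, b != 0 & u * sigma b = b.
    have [z z_moved] := sigma_nontrivial.
    pose b c := c + u * sigma c.
    have sb c : u * sigma (b c) = b c.
      by rewrite rmorphD rmorphM sigmaK mulrDr mulrA Nu mul1r addrC.
    have [b1|] := eqVneq (b 1) 0; last by exists (b 1).
    exists (b z) => //; rewrite /b.
    move: b1; rewrite /b rmorph1 mulr1 => /eqP; rewrite addrC addr_eq0.
    by move/eqP->; rewrite mulN1r subr_eq0 eq_sym.
  have sb0 : sigma b != 0 by rewrite fmorph_eq0.
  rewrite -card_fixed_star -(card_imset _ (mulIf b0)).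
  apply: eq_card => x; rewrite !inE; apply/andP/imsetP => [[x0 /eqP xu] | [y]].
    have sx0 : sigma x != 0 by rewrite fmorph_eq0.
    exists (x / b); last by field.
    rewrite !inE mulf_neq0 ?invr_neq0 //= rmorphM fmorphV.
    by apply/eqP; rewrite -[in RHS]su -xu; field; rewrite sb0 sx0 x0.
  rewrite !inE => /andP[y0 /eqP sy] ->; rewrite mulf_neq0 //; split=> //.
  by rewrite rmorphM sy; apply/eqP; rewrite -{1}su; field; rewrite y0 sb0.
move: fib; rewrite card_unit -(exp1n 2) subn_sqr exp1n mulnC addn1.
by move/eqP; rewrite eqn_pmul2r ?subn_gt0 // => /eqP.
Qed.

(** Nonempty fibres of the norm over nonzero values are cosets of [U], so the norm takes
    [(Q ^ 2 - 1) / (Q + 1) = Q - 1] nonzero values. These are fixed by [sigma], and there are only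
    [Q - 1] nonzero fixed elements, so all of them are norms. *)
Lemma card_norm_fiber c : c != 0 -> sigma c = c ->
  #|[set x | x * sigma x == c]| = Q.+1.
Proof.
move=> c0 sc; pose N x := x * sigma x; pose V := N @: [set~ 0].
have fibV y : y \in V -> #|[set x in [set~ 0] | N x == y]| = Q.+1.
  case/imsetP=> x; rewrite !inE => x0 ->; rewrite -card_norm1.
  have sx0 : sigma x != 0 by rewrite fmorph_eq0.
  rewrite -[RHS](card_imset _ (mulIf x0)); apply: eq_card => z; rewrite !inE.
  apply/andP/imsetP => [[z0 /eqP zx] | [u]].
    exists (z / x); last by field.
    rewrite inE rmorphM fmorphV mulrACA -invfM; apply/eqP.
    by move: zx; rewrite /N => ->; rewrite divff ?mulf_neq0.
  rewrite inE => /eqP Nu ->.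
  have u0 : u != 0.
    by apply: contra_eq_neq Nu => ->; rewrite mul0r eq_sym oner_eq0.
  by rewrite mulf_neq0 // /N rmorphM mulrACA Nu mul1r.
have cardV : #|V| = (Q - 1)%N.
  have : #|[set~ (0 : K)]| = (#|V| * Q.+1)%N.
    by apply: (card_fibers (f := N)) => // x xU; apply: imset_f.
  rewrite card_unit -(exp1n 2) subn_sqr exp1n addn1.
  by move/eqP; rewrite eqn_pmul2r // => /eqP.
have VE : V = K0 :\ 0.
  apply/eqP; rewrite eqEcard cardV card_fixed_star leqnn andbT.
  apply/subsetP => y /imsetP[x]; rewrite !inE => x0 {y}->.
  by rewrite mulf_neq0 ?fmorph_eq0 //= rmorphM sigmaK mulrC.
have cV : c \in V by rewrite VE !inE c0 sc /=.
rewrite -(fibV c cV); apply: eq_card => x; rewrite !inE /N.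
by have [->|//] := eqVneq x 0; rewrite mul0r eq_sym (negPf c0).
Qed.

(** The complement is counted: for given [a], the solutions [b] form the norm fibre over
    [- (1 + a * sigma a)], which is reduced to 0 for the [Q + 1] values [a] of norm -1 and has
    [Q + 1] elements otherwise. *)
Lemma card_herm_neq0 :
  #|[set u : K * K | 1 + u.1 * sigma u.1 + u.2 * sigma u.2 != 0]|%:Z =
  Q%:Z ^+ 4 - (Q%:Z + 1) * (Q%:Z ^+ 2 - Q%:Z).
Proof.
pose P (a b : K) := 1 + a * sigma a + b * sigma b == 0.
have sN1 : sigma (-1) = -1 by rewrite rmorphN rmorph1.
have fib a : #|[set b | P a b]| = if a * sigma a == -1 then 1%N else Q.+1.
  case: ifP => [/eqP Na | Na].
    rewrite -(cards1 (0 : K)); apply: eq_card => b; rewrite !inE /P Na subrr add0r.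
    by rewrite mulf_eq0 fmorph_eq0 orbb.
  rewrite -(@card_norm_fiber (- (1 + a * sigma a))).
  - by apply: eq_card => b; rewrite !inE /P addrC addr_eq0.
  - by rewrite oppr_eq0 addrC addr_eq0 Na.
  by rewrite rmorphN rmorphD rmorphM rmorph1 sigmaK [sigma a * a]mulrC.
have cardP : #|[set u : K * K | P u.1 u.2]| = (Q.+1 + (Q ^ 2 - Q.+1) * Q.+1)%N.
  rewrite card_dep_pairs (eq_bigr _ (fun a _ => fib a)).
  rewrite (bigID (fun a => a * sigma a == -1)) /=.
  rewrite (eq_bigr (fun _ => 1%N)) => [|a ->] //.
  rewrite [X in (_ + X)%N](eq_bigr (fun _ => Q.+1)) => [|a /negPf->] //.
  rewrite sum1dep_card sum_nat_cond_const.
  have cN : #|[set a | a * sigma a == -1]| = Q.+1.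
    by rewrite card_norm_fiber ?oppr_eq0 ?oner_eq0.
  rewrite cN; congr (_ + _ * _)%N.
  rewrite -cardK -cN -(cardsC [set a | a * sigma a == -1]) addKn.
  by apply: eq_card => a; rewrite !inE.
have Q2 : (Q.+1 <= Q ^ 2)%N by nia.
have := cardsC [set u : K * K | P u.1 u.2]; rewrite cardP card_prod cardK.
rewrite (_ : ~: _ = [set u | 1 + u.1 * sigma u.1 + u.2 * sigma u.2 != 0]); last first.
  by apply/setP=> u; rewrite !inE.
move/(congr1 Posz); rewrite PoszD => /(canRL (addKr _)) ->.
rewrite PoszD !PoszM -(subzn Q2) -mulnn !PoszM -addn1 PoszD; ring.
Qed.

End NormCount.

(** * Counting pairs modulo a polynomial *)

Lemma inj_card_bij_pred (T U : finType) (f : T -> U) (P : pred U) :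
  injective f -> (#|U| <= #|T|)%N -> #|[set x | P (f x)]| = #|[set y | P y]|.
Proof.
move=> f_inj leUT; have f_bij := inj_card_bij f_inj leUT.
rewrite -(on_card_preimset (f := f)); last exact: onW_bij.
by apply: eq_card => x; rewrite !inE.
Qed.

Section PolyCongruence.

Variable F : fieldType.
Implicit Types (P a b u v Y : {poly F}).

Lemma dvdp_comp_sub a u v : u - v %| (a \Po u) - (a \Po v).
Proof.
elim/poly_ind: a => [|a c IHa]; first by rewrite !comp_poly0 subrr dvdp0.
rewrite !comp_poly_MXaddC.
have -> : (a \Po u) * u + c%:P - ((a \Po v) * v + c%:P) =
   ((a \Po u) - (a \Po v)) * u + (a \Po v) * (u - v) by ring.
by apply: dvdp_add; [exact: dvdp_mulr | exact: dvdp_mull].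
Qed.

Lemma dvdp_sub_trans P v u w : P %| u - v -> P %| v - w -> P %| u - w.
Proof. by move=> Puv Pvw; rewrite -[u](subrK v) -addrA dvdp_add. Qed.

Lemma coprimep_congr P u v : P %| u - v -> coprimep P u = coprimep P v.
Proof.
case/dvdpP=> c /eqP; rewrite subr_eq => /eqP->.
by rewrite coprimep_addl_mul.
Qed.

Lemma dvdp_congr P u v : P %| u - v -> (P %| u) = (P %| v).
Proof. by move=> Puv; rewrite -[u](subrK v) dvdp_addr. Qed.

Lemma modp_congr P u v : P %| u - v -> u %% P = v %% P.
Proof. by move/modp_eq0; rewrite modpD modpN => /eqP; rewrite subr_eq0 => /eqP. Qed.

(* [Y] represents the image of [x] under the involution, so that [a \Po Y] is
   the conjugate of [a]; for negacirculant codes [1/x = x^(2n-1)]. *)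
Definition comp_form Y a b := 1 + a * (a \Po Y) + b * (b \Po Y).

Lemma comp_form_congr P Y a a' b b' : P %| P \Po Y ->
  P %| a - a' -> P %| b - b' -> P %| comp_form Y a b - comp_form Y a' b'.
Proof.
move=> stP Pa Pb.
have comp_congr c c' : P %| c - c' -> P %| (c \Po Y) - (c' \Po Y).
  by move=> Pc; rewrite -comp_polyB (dvdp_trans stP) // dvdp_comp_poly.
have mul_congr c c' : P %| c - c' -> P %| c * (c \Po Y) - c' * (c' \Po Y).
  move=> Pc.
  have -> : c * (c \Po Y) - c' * (c' \Po Y) =
      (c - c') * (c \Po Y) + c' * ((c \Po Y) - (c' \Po Y)) by ring.
  by apply: dvdp_add; [exact: dvdp_mulr | exact/dvdp_mull/comp_congr].
have -> : comp_form Y a b - comp_form Y a' b' =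
    (a * (a \Po Y) - a' * (a' \Po Y)) + (b * (b \Po Y) - b' * (b' \Po Y)).
  by rewrite /comp_form; ring.
by rewrite dvdp_add // mul_congr.
Qed.

End PolyCongruence.

Section UnitPairs.

Variable F : finFieldType.
Implicit Types (P a b Y : {poly F}).

(** Intended for [k] equal to the degree of [P]: then [{poly_k F}] is a system of representatives
    modulo [P], and coprimality with [P] says that the form is a unit modulo [P]. *)
Definition unit_pairs Y k P : nat :=
  #|[set u : {poly_k F} * {poly_k F} | coprimep P (comp_form Y u.1 u.2)]|.

Definition residue k P a : {poly_k F} := npolyp k (a %% P).

Lemma residue_congr k P a : size P = k.+1 -> P %| a - (residue k P a : {poly F}).
Proof.
move=> sP; have P0 : P != 0 by rewrite -size_poly_eq0 sP.
rewrite npolypK; last by rewrite -ltnS -sP ltn_modp.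
by rewrite {1}(divp_eq a P) addrK dvdp_mull.
Qed.

Lemma eq_npoly_congr k P (a b : {poly_k F}) :
  size P = k.+1 -> P %| (a : {poly F}) - (b : {poly F}) -> a = b.
Proof.
move=> sP Pab; apply/val_inj/eqP; rewrite /= -subr_eq0.
apply/negPn/negP => ab0; have := dvdp_leq ab0 Pab.
rewrite sP leqNgt ltnS (leq_trans (size_polyD _ _)) //.
by rewrite geq_max size_polyN !size_npoly.
Qed.

(** Chinese remainder theorem: taking residues modulo both factors is injective, hence bijective by
    cardinality. The stability of [P1] and [P2] under [Y] makes the form, which involves conjugates,
    depend only on the residues. *)
Lemma unit_pairs_mul Y k1 k2 P1 P2 :
  size P1 = k1.+1 -> size P2 = k2.+1 -> coprimep P1 P2 ->
  P1 %| P1 \Po Y -> P2 %| P2 \Po Y ->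
  unit_pairs Y (k1 + k2) (P1 * P2) = (unit_pairs Y k1 P1 * unit_pairs Y k2 P2)%N.
Proof.
move=> sP1 sP2 coP12 st1 st2.
have P10 : P1 != 0 by rewrite -size_poly_eq0 sP1.
have P20 : P2 != 0 by rewrite -size_poly_eq0 sP2.
have sP : size (P1 * P2) = (k1 + k2).+1 by rewrite size_mul // sP1 sP2 addnS.
pose r1 (a : {poly_(k1 + k2) F}) := residue k1 P1 a.
pose r2 (a : {poly_(k1 + k2) F}) := residue k2 P2 a.
have r_inj (x y : {poly_(k1 + k2) F}) : r1 x = r1 y -> r2 x = r2 y -> x = y.
  have cong k P (sPk : size P = k.+1) : residue k P x = residue k P y ->
      P %| (x : {poly F}) - (y : {poly F}).
    move=> e; apply: (dvdp_sub_trans (residue_congr x sPk)).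
    by rewrite e -opprB dvdpNr residue_congr.
  move=> e1 e2; apply: (eq_npoly_congr sP).
  by rewrite Gauss_dvdp // (cong _ _ sP1 e1) (cong _ _ sP2 e2).
pose f (u : {poly_(k1 + k2) F} * {poly_(k1 + k2) F}) :=
  ((r1 u.1, r1 u.2), (r2 u.1, r2 u.2)).
rewrite /unit_pairs -cardsX.
pose A := fun v : ({poly_k1 F} * {poly_k1 F}) * ({poly_k2 F} * {poly_k2 F}) =>
  coprimep P1 (comp_form Y v.1.1 v.1.2) && coprimep P2 (comp_form Y v.2.1 v.2.2).
rewrite [setX _ _](_ : _ = [set v | A v]); last first.
  by apply/setP=> v; rewrite !inE.
rewrite -(inj_card_bij_pred (f := f)).
- apply: eq_card => u; rewrite !inE /A /= coprimepMl.
  by congr (_ && _); apply/coprimep_congr/comp_form_congr => //; apply: residue_congr.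
- by move=> [a b] [a' b'] [] /= ? ? ? ?; congr (_, _); apply: r_inj.
by rewrite !card_prod !card_npoly -!expnD leq_exp2l ?finNzRing_gt1 //; lia.
Qed.

Lemma unit_pairs0 Y : unit_pairs Y 0 1 = 1%N.
Proof.
rewrite /unit_pairs (eq_card (B := predT)) => [|u]; last by rewrite !inE coprime1p.
by rewrite card_prod !card_npoly !expn0.
Qed.

Lemma unit_pairs_scale Y k c P :
  c != 0 -> unit_pairs Y k (c *: P) = unit_pairs Y k P.
Proof.
by move=> c0; apply: eq_card => u; rewrite !inE (eqp_coprimepl _ (eqp_scale P c0)).
Qed.

Lemma unit_pairs_prod Y (I : eqType) (r : seq I) (P : I -> {poly F}) :
  separable_poly (\prod_(i <- r) P i) ->
  {in r, forall i, P i %| P i \Po Y} ->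
  unit_pairs Y (size (\prod_(i <- r) P i)).-1 (\prod_(i <- r) P i) =
  (\prod_(i <- r) unit_pairs Y (size (P i)).-1 (P i))%N.
Proof.
elim: r => [|i r IHr]; first by rewrite !big_nil size_poly1 unit_pairs0.
rewrite !big_cons separable_mul.
set Q := \prod_(j <- r) P j; case/and3P => sepi sepQ coiQ st.
have sti : P i %| P i \Po Y by apply: st; rewrite mem_head.
have str : {in r, forall j, P j %| P j \Po Y}.
  by move=> j rj; apply: st; rewrite in_cons rj orbT.
have size1 (R : {poly F}) : separable_poly R -> size R = (size R).-1.+1.
  by move/separable_poly_neq0 => R0; rewrite prednK // size_poly_gt0.
have stQ : Q %| Q \Po Y.
  rewrite /Q big_seq; elim/big_rec: _ => [|j R rj stR]; first by rewrite dvd1p.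
  by rewrite comp_polyM dvdp_mul ?str.
rewrite -IHr // -(unit_pairs_mul (size1 _ sepi) (size1 _ sepQ)) //.
rewrite size_mul ?separable_poly_neq0 // (size1 _ sepi) (size1 _ sepQ).
by rewrite addSn addnS.
Qed.

End UnitPairs.

(** * The irreducible factors *)

(** The field is known only through its order and the kernel of [phi]. The quotient construction
    requires a monic modulus, so [h] is first rescaled, which does not affect divisibility. *)
Lemma irreducible_quotient (F : finFieldType) (h : {poly F}) :
  irreducible_poly h ->
  exists (K : finFieldType) (phi : {rmorphism {poly F} -> K}),
    #|K| = (#|F| ^ (size h).-1)%N /\ forall a, (phi a == 0) = (h %| a).
Proof.
move=> irr_h; have h0 := irredp_neq0 irr_h.
pose c := (lead_coef h)^-1; have c0 : c != 0 by rewrite invr_eq0 lead_coef_eq0.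
pose h' := c *: h.
have irr_h' : irreducible_poly h'.
  case: irr_h => sh irr; split=> [|p sp]; first by rewrite size_scale.
  by rewrite dvdpZr // (eqp_rtrans (eqp_scale h c0)); apply: irr.
have mon_h' : h' \is monic by rewrite monicE lead_coefZ mulVf ?lead_coef_eq0.
pose hI : monic_irreducible_poly h' := (irr_h', mon_h').
exists {poly %/ h' with hI}, (in_qpoly h'); split.
  by rewrite card_qfpoly size_scale.
move=> a; rewrite -(dvdpZl _ _ c0) -/h' -val_eqE /=.
have := mk_monicE hI => ->.
by rewrite -Pdiv.IdomainMonic.modpE.
Qed.

Section Quotient.

Variables (F : finFieldType) (Y h : {poly F}) (K : finFieldType).
Variable phi : {rmorphism {poly F} -> K}.
Hypothesis cardK : #|K| = (#|F| ^ (size h).-1)%N.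
Hypothesis phi_eq0 : forall a, (phi a == 0) = (h %| a).
Hypothesis irr_h : irreducible_poly h.

Lemma quotient_eq a b : (phi a == phi b) = (h %| a - b).
Proof. by rewrite -subr_eq0 -rmorphB phi_eq0. Qed.

Let phi_n (a : {poly_((size h).-1) F}) := phi a.

Lemma quotient_npoly_inj : injective phi_n.
Proof.
move=> a b /eqP; rewrite quotient_eq; apply: eq_npoly_congr.
by rewrite prednK // size_poly_gt0 irredp_neq0.
Qed.

Lemma quotient_surj : exists psi : K -> {poly F}, cancel psi phi.
Proof.
have [] : bijective phi_n.
  by apply: (inj_card_bij quotient_npoly_inj); rewrite cardK card_npoly.
by move=> g _ phi_nK; exists g.
Qed.

Lemma coprimep_quotient u : coprimep h u = (phi u != 0).
Proof. by rewrite phi_eq0 irreducible_poly_coprime. Qed.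

Lemma quotient_involution : h %| h \Po Y ->
  exists sigma : {rmorphism K -> K}, forall a, sigma (phi a) = phi (a \Po Y).
Proof.
move=> stable; have [psi psiK] := quotient_surj.
(* Lift to a polynomial, conjugate, reduce again; [h %| h \Po Y] makes the result independent of the
   lift, whence [s] is a ring morphism although [psi] need not be one. *)
pose s y := phi (psi y \Po Y).
have sE a : s (phi a) = phi (a \Po Y).
  apply/eqP; rewrite quotient_eq -comp_polyB (dvdp_trans stable) // dvdp_comp_poly //.
  by rewrite -quotient_eq psiK.
have sB : zmod_morphism s.
  by move=> x y; rewrite -[x]psiK -[y]psiK -rmorphB !sE comp_polyB rmorphB.
have sM : monoid_morphism s.
  split=> [|x y]; first by rewrite -(rmorph1 phi) sE comp_polyC.
  by rewrite -[x]psiK -[y]psiK -rmorphM !sE comp_polyM rmorphM.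
pose sA := GRing.isZmodMorphism.Build K K s sB.
pose sR := GRing.isMonoidMorphism.Build K K s sM.
pose sigma : {rmorphism K -> K} := HB.pack s sA sR.
by exists sigma.
Qed.

Lemma quotient_norm_involution : h %| h \Po Y -> h %| (Y \Po Y) - 'X ->
    ~~ (h %| Y - 'X) ->
  exists sigma : {rmorphism K -> K}, [/\ forall a, sigma (phi a) = phi (a \Po Y),
    involutive sigma & exists z, sigma z != z].
Proof.
move=> stable YY Y_neqX; have [sigma sE] := quotient_involution stable.
have [psi psiK] := quotient_surj; exists sigma; split=> // [x|].
  rewrite -[x]psiK !sE -comp_polyA; apply/eqP; rewrite quotient_eq.
  by apply: dvdp_trans YY _; rewrite -{2}[psi x]comp_polyXr dvdp_comp_sub.
by exists (phi 'X); rewrite sE comp_polyX quotient_eq.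
Qed.

End Quotient.

(** A hyperbola has [#|K| - 1] points and the pair of axes [2 * #|K| - 1]; the successor on the left
    avoids truncated subtraction. *)
Lemma card_mul_fiber (K : finFieldType) (c : K) :
  #|[set u : K * K | u.1 * u.2 == c]|.+1 =
  if c == 0 then (#|K| + #|K|)%N else #|K|.
Proof.
have K_gt0 : (0 < #|K|)%N by apply: ltnW; apply: finNzRing_gt1.
rewrite (card_dep_pairs (fun x y : K => x * y == c)) (bigD1 0) //=.
case: eqVneq => [->|c0].
  rewrite (eq_bigr (fun _ => 1%N)) => [|x x0].
    rewrite sum1_card cardC1.
    have -> : #|[set y : K | 0 * y == 0]| = #|K|.
      by rewrite -cardsT; apply: eq_card => y; rewrite !inE mul0r eqxx.
    by rewrite -addnS prednK.
  by rewrite -(cards1 (0 : K)); apply: eq_card => y; rewrite !inE mulf_eq0 (negPf x0).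
rewrite (eq_bigr (fun _ => 1%N)) => [|x x0].
  rewrite sum1_card cardC1.
  have -> : #|[set y : K | 0 * y == c]| = 0%N.
    by apply: eq_card0 => y; rewrite !inE mul0r eq_sym (negPf c0).
  by rewrite add0n prednK.
rewrite -(cards1 (x^-1 * c)); apply: eq_card => y; rewrite !inE.
by rewrite -[RHS](inj_eq (mulfI x0)) mulVKf.
Qed.

(** Again by the complement: given the first pair [x], the second lies on the curve of product
    [- (1 + x.1 * x.2)], which degenerates to the two axes exactly when [x.1 * x.2 = -1]. *)
Lemma card_eucl_neq0 (K : finFieldType) (Q := #|K|%:Z) :
  #|[set v : (K * K) * (K * K) | 1 + v.1.1 * v.1.2 + v.2.1 * v.2.2 != 0]|%:Z =
  Q ^+ 4 - Q ^+ 3 + Q.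
Proof.
have K_gt0 : (0 < #|K|)%N by apply: ltnW; apply: finNzRing_gt1.
pose P (x y : K * K) := 1 + x.1 * x.2 + y.1 * y.2 == 0.
have PE x y : P x y = (y.1 * y.2 == - (1 + x.1 * x.2)).
  by rewrite /P addrC addr_eq0.
have N1 := card_mul_fiber (-1 : K); rewrite oppr_eq0 oner_eq0 in N1.
have fib x : #|[set y | P x y]| =
    if x.1 * x.2 == -1 then (#|K| + #|K| - 1)%N else (#|K| - 1)%N.
  have := card_mul_fiber (- (1 + x.1 * x.2)); rewrite oppr_eq0 addrC addr_eq0.
  rewrite (eq_card (B := [set y | P x y])) => [|y]; last by rewrite !inE PE [_ + 1]addrC.
  by case: ifP => _ <-; rewrite subn1.
have cardP : #|[set v | P v.1 v.2]| = ((#|K| - 1) * (#|K| + #|K| - 1) +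
    (#|K| * #|K| - (#|K| - 1)) * (#|K| - 1))%N.
  rewrite card_dep_pairs (eq_bigr _ (fun x _ => fib x)).
  rewrite (bigID (fun x : K * K => x.1 * x.2 == -1)) /=.
  rewrite (eq_bigr (fun _ => #|K| + #|K| - 1)%N) => [|a ->] //.
  rewrite [X in (_ + X)%N](eq_bigr (fun _ => #|K| - 1)%N) => [|a /negPf->] //.
  rewrite !sum_nat_cond_const.
  have cN : #|[set x : K * K | x.1 * x.2 == -1]| = (#|K| - 1)%N by rewrite -N1 subn1.
  rewrite cN; congr (_ + _ * _)%N.
  rewrite -cN -card_prod -(cardsC [set x : K * K | x.1 * x.2 == -1]) addKn.
  by apply: eq_card => a; rewrite !inE.
have := cardsC [set v | P v.1 v.2]; rewrite cardP !card_prod.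
rewrite (_ : ~: _ =
    [set v : (K * K) * (K * K) | 1 + v.1.1 * v.1.2 + v.2.1 * v.2.2 != 0]);
  last by apply/setP=> v; rewrite !inE.
rewrite /Q; move: #|K| K_gt0 => [|m] // _; rewrite subn1 /= addnS subn1 /=.
have -> : (m.+1 * m.+1 - m = m * m + m + 1)%N by lia.
move/(congr1 Posz); rewrite PoszD => /(canRL (addKr _)) ->.
by rewrite -[m.+1]addn1 !(PoszD, PoszM); ring.
Qed.

Lemma PoszX m n : (m ^ n)%N%:Z = m%:Z ^+ n.
Proof. by rewrite -!natz natrX. Qed.

(** * Unit pairs modulo a self-reciprocal factor and modulo a reciprocal pair *)

Section UnitPairCounts.

Variables (F : finFieldType) (Y : {poly F}).
Local Notation Q := (#|F|%:Z).

Lemma unit_pairs_herm (g : {poly F}) d :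
  (2%:R : F) != 0 -> irreducible_poly g -> size g = (2 * d).+1 ->
  g %| g \Po Y -> g %| (Y \Po Y) - 'X -> ~~ (g %| Y - 'X) ->
  (unit_pairs Y (2 * d) g)%:Z =
    Q ^+ (4 * d) - (Q ^+ d + 1) * (Q ^+ (2 * d) - Q ^+ d).
Proof.
move=> two_neq0 irr_g sg stable YY Y_neqX.
have [K [phi [cardK phi_eq0]]] := irreducible_quotient irr_g.
have [sigma [sE sigmaK nontriv]] :=
  quotient_norm_involution cardK phi_eq0 irr_g stable YY Y_neqX.
have two_neq0K : (2%:R : K) != 0.
  rewrite -(rmorph_nat phi) phi_eq0 -polyC_natr; apply/negP => /dvdp_leq.
  by rewrite polyC_eq0 size_polyC two_neq0 leqNgt; case: irr_g => -> _ /(_ isT).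
rewrite sg /= mulnC expnM in cardK.
have := card_herm_neq0 sigmaK nontriv two_neq0K cardK.
rewrite !PoszX -!exprM [(d * 4)%N]mulnC [(d * 2)%N]mulnC => <-; congr Posz.
rewrite /unit_pairs
  -(inj_card_bij_pred (f := fun u : {poly_(2 * d) F} * {poly_(2 * d) F} =>
  (phi u.1, phi u.2))).
- apply: eq_card => u; rewrite !inE /= (coprimep_quotient phi_eq0) //.
  by rewrite !rmorphD !rmorphM rmorph1 !sE.
- move=> [a b] [a' b'] [] /eqP + /eqP; rewrite !(quotient_eq phi_eq0) => Ea Eb.
  by congr (_, _); apply: (eq_npoly_congr sg).
by rewrite !card_prod !card_npoly cardK mulnC expnM.
Qed.

(** The residue of [a] modulo [h'] is replaced by that of [a \Po Y] modulo [h], so both coordinates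
    of [a] live in the single field [F[x]/<h>] and conjugation swaps them. *)
Lemma unit_pairs_eucl (h h' : {poly F}) e :
  irreducible_poly h -> coprimep h h' -> size h = e.+1 -> size h' = e.+1 ->
  irreducible_poly h' ->
  h %| h' \Po Y -> h' %| h \Po Y -> h * h' %| (Y \Po Y) - 'X ->
  (unit_pairs Y (e + e) (h * h'))%:Z = Q ^+ (4 * e) - Q ^+ (3 * e) + Q ^+ e.
Proof.
move=> irr_h co sh sh' irr_h' hY h'Y YY.
have [K [phi [cardK phi_eq0]]] := irreducible_quotient irr_h.
have h0 := irredp_neq0 irr_h; have h'0 := irredp_neq0 irr_h'.
have sP : size (h * h') = (e + e).+1 by rewrite size_mul // sh sh' addnS.
have compYY a : h * h' %| ((a \Po Y) \Po Y) - a.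
  rewrite -comp_polyA; apply: dvdp_trans YY _.
  by rewrite -{2}[a]comp_polyXr dvdp_comp_sub.
have dvd_h' a : (h' %| a) = (h %| a \Po Y).
  apply/idP/idP => ha; first exact: dvdp_trans hY (dvdp_comp_poly _ ha).
  rewrite -(@dvdp_congr _ _ ((a \Po Y) \Po Y)).
    exact: dvdp_trans h'Y (dvdp_comp_poly _ ha).
  exact: dvdp_trans (dvdp_mull h (dvdpp h')) (compYY a).
(* For a self-conjugate [u], such as a value of the form, divisibility by [h'] and by [h] are
   equivalent, so the two coprimality conditions collapse into one. *)
have coprimeE u : h %| (u \Po Y) - u -> coprimep (h * h') u = (phi u != 0).
  move=> uY; rewrite coprimepMl (coprimep_quotient phi_eq0) //.
  by rewrite irreducible_poly_coprime // dvd_h' (dvdp_congr uY) phi_eq0 andbb.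
have := card_eucl_neq0 K; rewrite cardK sh /= !PoszX -!exprM ![(e * _)%N]mulnC => <-.
congr Posz; pose f (a : {poly_(e + e) F}) := (phi a, phi (a \Po Y)).
have f_inj : injective f.
  move=> a b [] /eqP + /eqP; rewrite !(quotient_eq phi_eq0) -comp_polyB -dvd_h' => E1 E2.
  by apply: (eq_npoly_congr sP); rewrite Gauss_dvdp // E1 E2.
rewrite /unit_pairs
  -(inj_card_bij_pred (f := fun u : {poly_(e + e) F} * {poly_(e + e) F} =>
  (f u.1, f u.2))).
- apply: eq_card => u; rewrite !inE coprimeE.
    by rewrite !rmorphD !rmorphM rmorph1.
  have invol (a : {poly F}) : h %| ((a * (a \Po Y)) \Po Y) - (a * (a \Po Y)).
    rewrite comp_polyM [a * _]mulrC -mulrBr dvdp_mull //.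
    exact: dvdp_trans (dvdp_mulr h' (dvdpp h)) (compYY a).
  set u1 := polyn u.1; set u2 := polyn u.2.
  have -> : (comp_form Y u1 u2 \Po Y) - comp_form Y u1 u2 =
      (((u1 * (u1 \Po Y)) \Po Y) - u1 * (u1 \Po Y)) +
      (((u2 * (u2 \Po Y)) \Po Y) - u2 * (u2 \Po Y)).
    by rewrite /comp_form !comp_polyD comp_polyC; ring.
  by rewrite dvdp_add.
- move=> [a b] [a' b'] E; congr (_, _).
    exact: f_inj (congr1 fst E).
  exact: f_inj (congr1 snd E).
by rewrite !card_prod !card_npoly cardK sh /= expnD.
Qed.

End UnitPairCounts.

(** * Sums of two squares and the factor ['X + 1] *)

Lemma irreducible_X2D1 (F : fieldType) :
  (forall y : F, y ^+ 2 != -1) -> irreducible_poly ('X^2 + 1 : {poly F}).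
Proof.
move=> nsq; apply: cubic_irreducible => [|y].
  by rewrite -[1]polyC1 size_XnaddC.
by rewrite rootE !hornerE addr_eq0 nsq.
Qed.

Lemma card_sum_two_squares (F : finFieldType) : (2%:R : F) != 0 ->
  #|[set u : F * F | u.1 ^+ 2 + u.2 ^+ 2 == -1]|%:Z =
  #|F|%:Z - quad_char (-1 : F).
Proof.
move=> two_neq0; rewrite /quad_char oppr_eq0 oner_eq0.
have [/existsP[i /eqP i2]|] := boolP [exists y : F, y ^+ 2 == -1].
  have i0 : i != 0.
    by apply: contra_eq_neq i2 => ->; rewrite expr0n /= eq_sym oppr_eq0 oner_eq0.
  have := card_mul_fiber (-1 : F); rewrite oppr_eq0 oner_eq0 => <-.
  rewrite intS addrC addKr; congr Posz.
  (* With [i ^+ 2 = -1], the linear change of variables [(a + i b, a - i b)] turns [a^2 + b^2] into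
     a product; it is injective because 2 and [i] are nonzero. *)
  rewrite -[RHS](inj_card_bij_pred
    (f := fun u : F * F => (u.1 + i * u.2, u.1 - i * u.2))) //.
    apply: eq_card => u; rewrite !inE /=.
    have -> : (u.1 + i * u.2) * (u.1 - i * u.2) = u.1 ^+ 2 - i ^+ 2 * u.2 ^+ 2 by ring.
    by rewrite i2 mulN1r opprK.
  move=> [a b] [a' b'] [] /= E E'.
  have ea : a = a'.
    apply: (mulfI two_neq0).
    have -> : 2%:R * a = (a + i * b) + (a - i * b) by ring.
    by rewrite E E'; ring.
  by move: E; rewrite ea => /addrI /(mulfI i0) ->.
rewrite negb_exists => /forallP nsq.
(* When -1 is not a square, [a^2 + b^2] is the norm of [a + b x] in [F[x]/<x^2 + 1>] for the
   conjugation [x |-> -x], so the solutions form the norm fibre over -1, of size [#|F| + 1]. *)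
pose h : {poly F} := 'X^2 + 1; pose Y : {poly F} := - 'X.
have irr_h : irreducible_poly h := irreducible_X2D1 nsq.
have sh : size h = 3 by rewrite /h -[1]polyC1 size_XnaddC.
have hY : h \Po Y = h.
  by rewrite /h comp_polyD comp_polyC comp_Xn_poly sqrrN.
have YY : (Y \Po Y) - 'X = 0.
  by rewrite /Y -scaleN1r comp_polyZ comp_polyX !scaleN1r opprK subrr.
have Y_neqX : ~~ (h %| Y - 'X).
  apply/negP => /dvdp_leq; rewrite sh /Y -opprD oppr_eq0 -mulr2n.
  rewrite -scaler_nat scaler_eq0 (negPf two_neq0) polyX_eq0 => /(_ isT).
  by rewrite size_polyN size_scale // size_polyX.
have [K [phi [cardK phi_eq0]]] := irreducible_quotient irr_h.
have [||sigma [sE sigmaK nontriv]] :=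
  quotient_norm_involution cardK phi_eq0 irr_h _ _ Y_neqX.
- by rewrite hY.
- by rewrite YY dvdp0.
have two_neq0K : (2%:R : K) != 0.
  rewrite -(rmorph_nat phi) phi_eq0 -polyC_natr; apply/negP => /dvdp_leq.
  by rewrite polyC_eq0 size_polyC two_neq0 sh => /(_ isT).
rewrite sh in cardK.
rewrite opprK addrC -intS.
rewrite -(@card_norm_fiber _ sigma _ sigmaK nontriv two_neq0K cardK (-1)).
- congr Posz; pose f (u : F * F) := phi (u.1%:P + u.2 *: 'X).
  rewrite -(inj_card_bij_pred (f := f)).
  + apply: eq_card => u; rewrite !inE /f sE -rmorphM.
    rewrite -(rmorphN1 phi) (quotient_eq phi_eq0).
    rewrite comp_polyD comp_polyC comp_polyZ comp_polyX.
    have -> : (u.1%:P + u.2 *: 'X) * (u.1%:P + u.2 *: Y) - -1 =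
        (u.1 ^+ 2 + u.2 ^+ 2 + 1)%:P - (u.2 ^+ 2)%:P * h.
      rewrite /Y /h -!mul_polyC !polyCD !polyCM polyC1; ring.
    rewrite dvdp_subl ?dvdp_mull //.
    apply/idP/idP => [/eqP-> | ]; first by rewrite addNr polyC0 dvdp0.
    rewrite -[_ == -1]subr_eq0 opprK; apply: contraLR => c0.
    apply/negP => /dvdp_leq.
    by rewrite polyC_eq0 size_polyC c0 sh => /(_ isT).
  + move=> [a b] [a' b'] /eqP; rewrite (quotient_eq phi_eq0) /=.
    set D := _ - _ => hD; have DE : D = (a - a')%:P + (b - b') *: 'X.
      by rewrite /D -!mul_polyC !polyCB; ring.
    have D0 : D = 0.
      apply/eqP/negPn/negP => /dvdp_leq/(_ hD); rewrite sh DE leqNgt ltnS.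
      rewrite (leq_trans (size_polyD _ _)) // geq_max (leq_trans (size_polyC_leq1 _)) //.
      by rewrite (leq_trans (size_scale_leq _ _)) ?size_polyX.
    have := congr1 (fun p : {poly F} => p`_0) D0.
    have := congr1 (fun p : {poly F} => p`_1) D0.
    rewrite DE !coefD !coefC !coefZ !coefX ?coef0 /= mulr1 mulr0 add0r addr0.
    by move=> /eqP; rewrite subr_eq0 => /eqP-> /eqP; rewrite subr_eq0 => /eqP->.
  by rewrite card_prod cardK mulnn.
- by rewrite oppr_eq0 oner_eq0.
by rewrite rmorphN rmorph1.
Qed.

(** Reduction modulo ['X + 1] is evaluation at -1, and [Y] fixes this point, so conjugation is
    trivial there and the form becomes [1 + a^2 + b^2]. *)
Lemma unit_pairs_XD1 (F : finFieldType) (Y : {poly F}) :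
  (2%:R : F) != 0 -> Y.[-1] = -1 ->
  (unit_pairs Y 1 ('X + 1))%:Z = #|F|%:Z ^+ 2 - #|F|%:Z + quad_char (-1 : F).
Proof.
move=> two_neq0 Y1.
have := card_sum_two_squares two_neq0.
set A := [set u | _]; move=> cA.
have -> : unit_pairs Y 1 ('X + 1) = #|~: A|.
  rewrite /A (_ : ~: _ = [set u : F * F | 1 + u.1 ^+ 2 + u.2 ^+ 2 != 0]); last first.
    by apply/setP => u; rewrite !inE -[_ == -1]subr_eq0 opprK addrC addrA.
  rewrite /unit_pairs -(inj_card_bij_pred
    (f := fun u : {poly_1 F} * {poly_1 F} => ((val u.1).[-1], (val u.2).[-1]))).
  - apply: eq_card => u; rewrite !inE coprimep_sym.
    have -> : 'X + 1 = 'X - (-1)%:P :> {poly F} by rewrite polyCN opprK.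
    by rewrite coprimep_XsubC rootE /comp_form !hornerE !horner_comp Y1 !expr2.
  - have val_inj1 (a b : {poly_1 F}) : (val a).[-1] = (val b).[-1] -> a = b.
      have aC := size1_polyC (size_npoly a); have bC := size1_polyC (size_npoly b).
      by rewrite /= aC bC !hornerC => E; apply: val_inj; rewrite /= aC bC E.
    by move=> [a b] [a' b'] [] /val_inj1 -> /val_inj1 ->.
  by rewrite !card_prod !card_npoly expn1.
have /(congr1 Posz) := cardsC A; rewrite card_prod PoszD PoszM cA.
by move=> /(canRL (addKr _)) ->; ring.
Qed.

(** * The modulus [X^n + 1] and the involution [x |-> 1/x] *)

Section NegacyclicModulus.

Variables (F : fieldType) (n : nat).
Hypothesis n_gt0 : (0 < n)%N.
Implicit Types (f P a b : {poly F}).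

Local Notation M := ('X^n + 1 : {poly F}).
Local Notation Y := ('X^((2 * n).-1) : {poly F}).

Lemma size_XnD1 : size M = n.+1.
Proof. by rewrite -[1]polyC1 size_XnaddC. Qed.

(** As [x^n = -1] modulo [M], one has [x^(2n) = 1]: exponents matter only modulo [2n], and [Y] plays
    the role of [1/x]. *)
Lemma dvdp_Xn_periodic k r : M %| 'X^(2 * n * k + r) - 'X^r.
Proof.
rewrite exprD -{2}['X^r]mul1r -mulrBl dvdp_mulr // exprM.
have -> : 'X^(2 * n) = 1 + M * ('X^n - 1) :> {poly F} by rewrite mulnC exprM; ring.
elim: k => [|k IHk]; first by rewrite expr0 subrr dvdp0.
rewrite exprS; set Z := 1 + _; have MZ : M %| Z - 1.
  by rewrite /Z addrAC subrr add0r dvdp_mulr.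
have -> : Z * Z ^+ k - 1 = (Z - 1) * Z ^+ k + (Z ^+ k - 1) by ring.
by rewrite dvdp_add // dvdp_mulr.
Qed.

Lemma comp_Xn_inv_inv : M %| (Y \Po Y) - 'X.
Proof.
rewrite comp_Xn_poly -exprM.
have -> : ((2 * n).-1 * (2 * n).-1 = 2 * n * (2 * n - 2) + 1)%N.
  by case: n n_gt0 => // m _; nia.
exact: dvdp_Xn_periodic.
Qed.

Lemma comp_XnD1 : M %| M \Po Y.
Proof.
rewrite comp_polyD comp_polyC comp_Xn_poly -exprM.
have -> : ((2 * n).-1 * n = 2 * n * n.-1 + n)%N.
  by case: n n_gt0 => // m _; nia.
by rewrite (dvdp_congr (v := M)) // opprD addrACA subrr addr0 dvdp_Xn_periodic.
Qed.

(** This is the defining formula [x^(deg f) f(1/x)], read modulo [M] with [Y] for [1/x]; it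
    translates reciprocation into conjugation up to the unit [x^(deg f)]. *)
Lemma reciprocal_comp f :
  M %| reciprocal f - 'X^((size f).-1) * (f \Po Y).
Proof.
have [->|f0] := eqVneq f 0.
  by rewrite /reciprocal size_poly0 poly_def big_ord0 comp_poly0 mulr0 subrr dvdp0.
rewrite /reciprocal poly_def (reindex_inj rev_ord_inj) /= comp_polyE mulr_sumr -sumrB.
elim/big_rec: _ => [|i p _ IHp]; first exact: dvdp0.
have revK s j : (j < s)%N -> (s.-1 - (s - j.+1) = j)%N by lia.
rewrite dvdp_add // -scalerAr -exprM -exprD revK //.
rewrite -scalerBr -mul_polyC dvdp_mull // -opprB dvdpNr.
have expE s j : (j < s)%N -> (s.-1 + (2 * n).-1 * j = 2 * n * j + (s - j.+1))%N.
  by case: n n_gt0 => // m _; nia.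
rewrite expE //.
exact: dvdp_Xn_periodic.
Qed.

Lemma coprimep_XnD1_Xn k : coprimep M 'X^k.
Proof.
rewrite coprimep_expr // coprimep_sym -['X]subr0 -polyC0 coprimep_sym coprimep_XsubC.
by rewrite rootE !hornerE ?oppr0 expr0n gtn_eqF // add0r oner_eq0.
Qed.

Lemma dvdp_reciprocal P f : P %| M -> (P %| reciprocal f) = (P %| f \Po Y).
Proof.
move=> PM; rewrite (dvdp_congr (dvdp_trans PM (reciprocal_comp f))).
by rewrite Gauss_dvdpr // (coprimep_dvdr PM) // coprimep_XnD1_Xn.
Qed.

Lemma self_reciprocal_comp g :
  g %| M -> self_reciprocal g -> g %| g \Po Y.
Proof.
move=> gM [c _ rg]; rewrite -dvdp_reciprocal // rg.
by rewrite -mul_polyC dvdp_mull.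
Qed.

Lemma reciprocal_comp_inv h : h %| M -> h %| reciprocal h \Po Y.
Proof.
move=> hM.
have E : M %| (reciprocal h \Po Y) - (('X^((size h).-1) * (h \Po Y)) \Po Y).
  rewrite -comp_polyB; apply: dvdp_trans comp_XnD1 _.
  exact/dvdp_comp_poly/reciprocal_comp.
rewrite (dvdp_congr (dvdp_trans hM E)) comp_polyM dvdp_mull //.
rewrite -comp_polyA (dvdp_congr (v := h)) //; apply: (dvdp_trans hM).
by apply: dvdp_trans comp_Xn_inv_inv _; rewrite -{2}[h]comp_polyXr dvdp_comp_sub.
Qed.

(** The degree could drop only if [h] vanished at 0, but [M] has constant coefficient 1. *)
Lemma size_reciprocal h : h %| M -> size (reciprocal h) = size h.
Proof.
move=> hM; have h0 : h`_0 != 0.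
  rewrite -horner_coef0; case/dvdpP: hM => c /(congr1 (horner^~ 0)).
  rewrite !hornerE expr0n gtn_eqF // add0r => /eqP.
  by apply: contraTneq => ->; rewrite mulr0 oner_eq0.
by rewrite size_poly_eq // subnn.
Qed.

(** If [1/x = x] modulo [g], then [g] divides [x^2 - 1] and is linear. Hence conjugation is
    nontrivial modulo any irreducible factor of higher degree. *)
Lemma inv_fixed_size g : g %| M -> irreducible_poly g -> g %| Y - 'X ->
  (size g <= 2)%N.
Proof.
move=> gM irr_g gY.
have : g %| ('X - 1%:P) * ('X + 1%:P).
  have -> : ('X - 1%:P) * ('X + 1%:P) =
      ('X^(2 * n * 1 + 0) - 'X^0) - 'X * (Y - 'X) :> {poly F}.
    rewrite mulrBr -exprS prednK ?muln_gt0 // muln1 addn0 expr0 polyC1; ring.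
  by rewrite dvdp_sub ?(dvdp_trans gM (dvdp_Xn_periodic _ _)) // dvdp_mull.
have [gX1|ngX1] := boolP (g %| 'X - 1%:P).
  by move=> _; rewrite (leq_trans (dvdp_leq _ gX1)) ?polyXsubC_eq0 ?size_XsubC.
rewrite Gauss_dvdpr ?irreducible_poly_coprime // => /dvdp_leq.
by rewrite size_XaddC -size_poly_eq0 size_XaddC; apply.
Qed.

Lemma separable_XnD1 : (n%:R : F) != 0 -> separable_poly M.
Proof.
move=> n0; rewrite separable_poly.unlock derivD derivXn derivC addr0.
by rewrite -scaler_nat (eqp_coprimepr _ (eqp_scale _ n0)) coprimep_XnD1_Xn.
Qed.

Lemma horner_N1_inv : Y.[-1] = -1.
Proof.
rewrite hornerXn; case: n n_gt0 => // m _.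
by rewrite mulnS /= add1n exprS exprM sqrrN !expr1n mulr1.
Qed.

End NegacyclicModulus.

(** Translation by 1 permutes [F], so adding 1 to each term leaves the sum of all elements
    unchanged. *)
Lemma natr_card_finField (F : finFieldType) : (#|F|%:R : F) = 0.
Proof.
apply: (addrI (\sum_(x : F) x)); rewrite addr0 -sumr_const -big_split /=.
by rewrite [RHS](reindex_inj (addIr 1)).
Qed.

Lemma coprime_natr_neq0 (F : finFieldType) n : coprime n #|F| -> (n%:R : F) != 0.
Proof.
have [p p_pr charF] := finPcharP F; apply: contraTneq => /eqP.
rewrite -(dvdn_pcharf charF) => pn; apply/negP => /(coprime_dvdl pn).
have pF : (p %| #|F|)%N by rewrite (dvdn_pcharf charF) natr_card_finField.
move/(coprime_dvdr pF); rewrite /coprime gcdnn => /eqP p1.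
by rewrite p1 in p_pr.
Qed.

(** * Negacirculant codes *)

Section Codes.

Variables (F : finFieldType) (n : nat).
Hypothesis n_gt0 : (0 < n)%N.

Local Notation M := ('X^n + 1 : {poly F}).
Local Notation Y := ('X^((2 * n).-1) : {poly F}).
Local Notation R := {poly %/ M}.
Implicit Types (a b r : R) (p : {poly F}).

Lemma monic_XnD1 : M \is monic.
Proof. by rewrite -[1]polyC1 monicXnaddC. Qed.

Lemma mk_monic_XnD1 : mk_monic M = M.
Proof. by rewrite /mk_monic size_XnD1 // ltnS n_gt0 monic_XnD1. Qed.

Lemma size_negaring a : (size (a : {poly F}) <= n)%N.
Proof.
rewrite -ltnS -(size_XnD1 F n_gt0) -{2}mk_monic_XnD1; exact: size_mk_monic.
Qed.

Lemma negaring_mulE a b : polyn (a * b) = (polyn a * polyn b) %% M.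
Proof.
rewrite poly_of_qpolyM; move: (_ * _) => p.
by rewrite mk_monic_XnD1 -Pdiv.IdomainMonic.modpE // monic_XnD1.
Qed.

Lemma size_modM p : (size (p %% M)%R <= n)%N.
Proof.
have M0 : M != 0 by rewrite -size_poly_eq0 size_XnD1.
by rewrite -ltnS -(size_XnD1 F n_gt0) ltn_modp.
Qed.

Lemma modM_congr p : M %| (p %% M) - p.
Proof. by rewrite {2}(divp_eq p M) opprD addrCA subrr addr0 dvdpNr dvdp_mull. Qed.

Definition negaring_of p : R := npolyp _ (p %% M).

Lemma negaring_ofE p : polyn (negaring_of p) = p %% M.
Proof. by rewrite npolypK // mk_monic_XnD1 size_XnD1 //= size_modM. Qed.

Lemma negaring_coefsK a : rVpoly (negaring_coefs a) = polyn a.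
Proof. by rewrite poly_rV_K // size_negaring. Qed.

Lemma negaring_modK c : polyn c %% M = polyn (c : R).
Proof. by rewrite modp_small // size_XnD1 // ltnS size_negaring. Qed.

Lemma negaring_coefs_inj : injective (@negaring_coefs F n).
Proof. by move=> a b E; apply/val_inj; rewrite /= -!negaring_coefsK E. Qed.

Definition codeword a b r : 'rV[F]_(n + (n + n)) :=
  row_mx (negaring_coefs r)
    (row_mx (negaring_coefs (r * a)) (negaring_coefs (r * b))).

Lemma mem_one_generator_code a b v :
  reflect (exists r, v = codeword a b r) (v \in one_generator_code a b).
Proof.
have cE r : negaring3_coefs (r *: \row_(i < 3) [:: 1; a; b]`_i) = codeword a b r.
  by rewrite /negaring3_coefs !mxE /= mulr1.
apply: (iffP imsetP) => [[w /imsetP[r _ ->] ->] | [r ->]]; first by exists r.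
by exists (r *: \row_(i < 3) [:: 1; a; b]`_i); [apply/imsetP; exists r | rewrite cE].
Qed.

(** A codeword whose first block is 1 has multiplier 1, so the code determines its generator;
    counting codes thus amounts to counting pairs. *)
Lemma one_generator_code_inj a b a' b' :
  one_generator_code a b = one_generator_code a' b' -> (a, b) = (a', b').
Proof.
move=> E; have : codeword a b 1 \in one_generator_code a' b'.
  by rewrite -E; apply/mem_one_generator_code; exists 1.
case/mem_one_generator_code => r /eq_row_mx[/negaring_coefs_inj <-].
by case/eq_row_mx; rewrite !mul1r => /negaring_coefs_inj -> /negaring_coefs_inj ->.
Qed.

Lemma negashift_modM p :
  negashift (poly_rV (p %% M) : 'rV_n) = poly_rV (('X * p) %% M).
Proof.
set q := p %% M; have sq : (size q <= n)%N := size_modM p.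
(* Multiplication by [x] raises the degree to at most [n]; removing the top term with [M] puts its
   negative in position 0, which is the sign of the negashift. *)
have -> : ('X * p) %% M = 'X * q - q`_n.-1 *: M.
  have sr : (size ('X * q - q`_n.-1 *: M)%R <= n)%N.
    apply/leq_sizeP => j lej.
    rewrite coefB coefXM coefZ coefD coefXn coef1.
    have j0 : (0 < j)%N by apply: leq_trans lej.
    rewrite gtn_eqF // addr0; have [->|nj] := eqVneq j n.
      by rewrite mulr1 subrr.
    rewrite mulr0 subr0 nth_default //.
    by apply: leq_trans sq _; lia.
  rewrite -modp_mul -/q -[RHS](modp_small (q := M)); last by rewrite size_XnD1 ?ltnS.
  by rewrite modpD modpN modpZl modpp scaler0 subr0.
apply/rowP => j; rewrite !mxE coefB coefXM coefZ coefD coefXn coef1.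
have jn := ltn_ord j.
rewrite (ltn_eqF jn) add0r.
case: eqP => [j0 | /eqP j0].
  rewrite mulr1 sub0r; congr (- q`_ _) => /=.
  by rewrite j0 add0n modn_small // prednK.
rewrite mulr0 subr0; congr (q`_ _) => /=.
rewrite -{1}(prednK (_ : 0 < j)%N) ?lt0n // addSn /=.
by rewrite modnDr modn_small // (leq_ltn_trans (leq_pred _) jn).
Qed.

(** Row [i] of the negacirculant matrix of [c] holds the coefficients of [x^i c], so the matrix acts
    as multiplication by [c] in [R], and the rows of [(I, A, B)] span exactly the codewords. *)
Lemma index3_negacirculant_one_generator a b :
  index3_negacirculant (one_generator_code a b).
Proof.
have iterE p i : iter i (@negashift F n) (poly_rV (p %% M)) = poly_rV (('X^i * p) %% M).
  elim: i => [|i IHi]; first by rewrite expr0 mul1r.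
  by rewrite iterS IHi negashift_modM mulrA -exprS.
pose circ c : 'M[F]_n := \matrix_(i < n) iter i (@negashift F n) (negaring_coefs c).
have mul_circ (u : 'rV_n) c : u *m circ c = poly_rV ((rVpoly u * polyn c) %% M).
  rewrite mulmx_sum_row [in RHS](row_sum_delta u) linear_sum /= mulr_suml.
  rewrite (big_morph (fun p => p %% M) (modpD M) (mod0p M)) linear_sum /=.
  apply: eq_bigr => i _; rewrite rowK [rVpoly _]linearZ /= rVpoly_delta.
  rewrite -scalerAl modpZl linearZ /=; congr (_ *: _).
  by rewrite /negaring_coefs -{1}(negaring_modK c) iterE.
apply/existsP; exists (circ a); apply/existsP; exists (circ b).
apply/and3P; split; [by apply/existsP; exists (negaring_coefs a)
  | by apply/existsP; exists (negaring_coefs b) |].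
apply/eqP/setP => v; rewrite inE; apply/mem_one_generator_code/submxP => [[r ->] | [u ->]].
  exists (negaring_coefs r).
  by rewrite !mul_mx_row mulmx1 !mul_circ !negaring_coefsK -!negaring_mulE.
exists (negaring_of (rVpoly u)).
rewrite !mul_mx_row mulmx1 !mul_circ /codeword /negaring_coefs !negaring_mulE negaring_ofE.
rewrite ![(_ %% M) * _]mulrC !modp_mul ![rVpoly u * _]mulrC.
by rewrite [rVpoly u %% M]modp_small ?rVpolyK // size_XnD1 // ltnS size_poly.
Qed.

Lemma modM_mul_comp p1 p2 :
  ((p1 %% M) * ((p2 %% M) \Po Y)) %% M = (p1 * (p2 \Po Y)) %% M.
Proof.
apply: modp_congr; apply: (dvdp_sub_trans (v := p1 * ((p2 %% M) \Po Y))).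
  by rewrite -mulrBl dvdp_mulr // modM_congr.
rewrite -mulrBr dvdp_mull // -comp_polyB.
exact: dvdp_trans (comp_XnD1 F n_gt0) (dvdp_comp_poly _ (modM_congr _)).
Qed.

Lemma coef0_modXn i j : (i < n)%N -> (j < n)%N ->
  ('X^(i + (2 * n).-1 * j) %% M)`_0 = (i == j)%:R :> F.
Proof.
move=> lt_in lt_jn.
have small k : (k < n)%N -> 'X^k %% M = 'X^k :> {poly F}.
  by move=> lt_kn; rewrite modp_small // size_XnD1 // size_polyXn ltnS.
have [le_ji|lt_ij] := leqP j i.
  have -> : (i + (2 * n).-1 * j = 2 * n * j + (i - j))%N by nia.
  rewrite (modp_congr (dvdp_Xn_periodic _ _ _ _)) small; last by lia.
  by rewrite coefXn eq_sym subn_eq0 eqn_leq le_ji andbT.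
(* For [i < j], the monomial is congruent to [- x^(n + i - j)], whose exponent lies strictly between
   0 and [n], so its constant coefficient vanishes. *)
have -> : (i + (2 * n).-1 * j = 2 * n * j.-1 + (n + (n + i - j)))%N by nia.
rewrite (modp_congr (dvdp_Xn_periodic _ _ _ _)).
rewrite (@modp_congr _ _ _ (- 'X^(n + i - j))); last first.
  by rewrite opprK exprD -{2}['X^(n + i - j)]mul1r -mulrDl dvdp_mulr.
rewrite modpN small; last by lia.
by rewrite coefN coefXn (ltn_eqF lt_ij) ltn_eqF ?oppr0 //; lia.
Qed.

(** Both sides are bilinear, and [coef0_modXn] says that the monomials [x^i], [i < n], are
    orthonormal for the right-hand side. *)
Lemma dot_coefs (x y : {poly F}) : (size x <= n)%N -> (size y <= n)%N ->
  ((poly_rV x : 'rV_n) *m (poly_rV y)^T) 0 0 = ((x * (y \Po Y)) %% M)`_0.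
Proof.
move=> sx sy; rewrite mxE.
have expand (z : {poly F}) : (size z <= n)%N -> z = \sum_(i < n) z`_i *: 'X^i.
  move=> sz; rewrite -poly_def; apply/polyP => k; rewrite coef_poly.
  by case: ltnP => // le_nk; rewrite nth_default // (leq_trans sz).
rewrite {2}(expand x sx) {2}(expand y sy).
rewrite [_ \Po _]linear_sum /= mulr_suml.
rewrite (big_morph (fun p => p %% M) (modpD M) (mod0p M)) coef_sum.
apply: eq_bigr => i _; rewrite mulr_sumr.
rewrite (big_morph (fun p => p %% M) (modpD M) (mod0p M)) coef_sum.
rewrite (bigD1 i) //= big1 ?addr0 => [|j /negPf ij].
  rewrite comp_polyZ comp_Xn_poly -exprM -scalerAl -scalerAr -exprD !modpZl !coefZ.
  by rewrite coef0_modXn // eqxx mulr1 !mxE.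
rewrite comp_polyZ comp_Xn_poly -exprM -scalerAl -scalerAr -exprD !modpZl !coefZ.
by rewrite coef0_modXn // [_ == _ :> nat]eq_sym (ij : (val j == val i) = false) !mulr0.
Qed.

Lemma codeword_dot a b r s :
  (codeword a b r *m (codeword a b s)^T) 0 0 =
  ((polyn r * comp_form Y (polyn a) (polyn b) * (polyn s \Po Y)) %% M)`_0.
Proof.
have term (c : R) : (negaring_coefs (r * c) *m (negaring_coefs (s * c))^T) 0 0 =
   ((polyn r * polyn c * ((polyn s * polyn c) \Po Y)) %% M)`_0.
  by rewrite dot_coefs ?size_negaring // !negaring_mulE modM_mul_comp.
rewrite /codeword !tr_row_mx !mul_row_col mxE [X in _ + X]mxE !term.
rewrite dot_coefs ?size_negaring // -!coefD -!modpD !comp_polyM /comp_form.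
congr ((_ %% M)`_0); move: (polyn r) (polyn s) (polyn a) (polyn b) => r' s' a' b'.
ring.
Qed.

Lemma LCD_one_generator_code a b :
  LCD (one_generator_code a b) = coprimep M (comp_form Y (polyn a) (polyn b)).
Proof.
set u := comp_form _ _ _.
have in_dual r : (codeword a b r \in euclidean_dual (one_generator_code a b)) =
    (M %| polyn r * u).
  rewrite inE; apply/forall_inP/idP => [orth | Mru c].
    pose w := (polyn r * u) %% M.
    suff w0 : w = 0 by rewrite /dvdp -/w w0.
    apply/polyP => k; rewrite coef0; have [lt_kn|] := ltnP k n; last first.
      by move=> le_nk; rewrite nth_default // (leq_trans (size_modM _)).
    (* Pairing with the codeword of multiplier [x^k] extracts the coefficient of index [k] of [w];
       orthogonality to all of them forces [w = 0]. *)
    pose s := negaring_of 'X^k.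
    have sE : polyn s = 'X^k.
      by rewrite negaring_ofE modp_small // size_XnD1 // size_polyXn ltnS.
    have /orth/eqP/matrixP/(_ 0 0) : codeword a b s \in one_generator_code a b.
      by apply/mem_one_generator_code; exists s.
    rewrite codeword_dot sE -/u -modM_mul_comp -/w mxE => w0.
    have sX : (size ('X^k : {poly F}) <= n)%N by rewrite size_polyXn.
    have := dot_coefs (size_modM (polyn r * u)) sX; rewrite -/w.
    rewrite [X in _ = (_ * (X \Po _) %% _)`_0 -> _](_ : _ = 'X^k %% M); last first.
      by rewrite modp_small // size_XnD1 // size_polyXn ltnS.
    rewrite w0 mxE (bigD1 (Ordinal lt_kn)) //= big1 ?addr0 => [|j /negPf jk].
      by rewrite !mxE coefXn eqxx mulr1.
    by rewrite !mxE coefXn (jk : (val j == k) = false) mulr0.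
  case/mem_one_generator_code => s ->; apply/eqP/matrixP => i j.
  rewrite !ord1 codeword_dot mxE (_ : _ %% M = 0) ?coef0 //.
  by apply/eqP; apply: dvdp_mulr.
have cw0 : codeword a b 0 = 0.
  by rewrite /codeword !mul0r /negaring_coefs /= linear0 !row_mx0.
rewrite /LCD; apply/eqP/idP => [triv | co].
  (* If [D] is not constant, the multiplier [M %/ D] is nonzero modulo [M] and [M] divides
     [(M %/ D) * u], so its codeword is a nonzero element of the intersection with the dual. *)
  apply: contraT => nco; pose D := gcdp M u.
  have DM : D %| M := dvdp_gcdl M u; have Du : D %| u := dvdp_gcdr M u.
  have ME : M = (M %/ D) * D by rewrite divpK.
  pose r := negaring_of (M %/ D).
  have : codeword a b r \in
      one_generator_code a b :&: euclidean_dual (one_generator_code a b).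
    rewrite inE in_dual; apply/andP; split.
      by apply/mem_one_generator_code; exists r.
    rewrite negaring_ofE (dvdp_congr (v := M %/ D * u)).
      by rewrite {1}ME dvdp_mul.
    by rewrite -mulrBl dvdp_mulr // modM_congr.
  rewrite triv inE -cw0 => /eqP/eq_row_mx[/negaring_coefs_inj r0 _].
  have D0 : D != 0 by apply: contraTneq DM => ->; rewrite dvd0p monic_neq0 // monic_XnD1.
  have MD0 : M %/ D != 0.
    by apply: contra_eq_neq ME => ->; rewrite mul0r monic_neq0 // monic_XnD1.
  have : M %| M %/ D by rewrite /dvdp -negaring_ofE -/r r0.
  move=> /(dvdp_leq MD0); rewrite size_divp // size_XnD1 //.
  move: nco; rewrite /coprimep -/D; have := D0; rewrite -size_poly_gt0.
  by case: (size D) => [|[|k]] // _ _; rewrite /= subSS leqNgt ltnS leq_subr.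
apply/setP => v; rewrite in_setI [RHS]inE; apply/andP/eqP => [[] | ->].
  case/mem_one_generator_code => r ->; rewrite in_dual Gauss_dvdpl // => Mr.
  suff -> : r = 0 by [].
  by apply/val_inj; rewrite /= -negaring_modK; apply/eqP.
split; first by apply/mem_one_generator_code; exists 0.
by rewrite -cw0 in_dual mul0r dvdp0.
Qed.

Lemma card_LCD_codes :
  #|[set C : {set 'rV[F]_(n + (n + n))} |
      [&& index3_negacirculant C, LCD C & one_generator C]]| = unit_pairs Y n M.
Proof.
pose A := [set u : R * R | coprimep M (comp_form Y (polyn u.1) (polyn u.2))].
have -> : unit_pairs Y n M = #|A|.
  (* Elements of [R] are polynomials of size at most [(size (mk_monic M)).-1], which equals [n] only
     by a proof; with that bound in place of [n], the two sets coincide by conversion. *)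
  have dimE : (size (mk_monic M)).-1 = n by rewrite mk_monic_XnD1 size_XnD1.
  have : unit_pairs Y (size (mk_monic M)).-1 M = #|A| by [].
  by rewrite dimE.
pose f (u : R * R) := one_generator_code u.1 u.2.
rewrite -(card_imset (f := f) A); last first.
  by move=> [a b] [a' b'] /one_generator_code_inj.
apply: eq_card => C; rewrite inE; apply/and3P/imsetP => [[_ lcd] | [[a b]]].
  case/existsP => a /existsP[b /eqP E]; exists (a, b) => //.
  by rewrite inE -LCD_one_generator_code -E.
rewrite inE => co ->; split; first exact: index3_negacirculant_one_generator.
  by rewrite LCD_one_generator_code.
by apply/existsP; exists a; apply/existsP; exists b.
Qed.

End Codes.

(** * Assembling the local counts *)

Theorem proposition7p3 (q : nat) (F : finFieldType) (n s t : nat) (alpha : F)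
    (g h : nat -> {poly F}) (d e : nat -> nat) :
  #|F| = q -> odd q -> (1 <= n)%N -> coprime n q ->
  alpha != 0 ->
  'X^n + 1 = alpha *: (\prod_(1 <= i < s.+1) g i *
                       \prod_(1 <= j < t.+1) (h j * reciprocal (h j))) ->
  (forall i, (1 <= i <= s)%N -> irreducible_poly (g i)) ->
  (forall j, (1 <= j <= t)%N ->
     irreducible_poly (h j) /\ irreducible_poly (reciprocal (h j))) ->
  (forall i, (1 <= i <= s)%N -> self_reciprocal (g i)) ->
  (odd n -> (1 <= s)%N /\ g 1%N = 'X + 1) ->
  (forall i, ((if odd n then 2 else 1) <= i <= s)%N ->
     size (g i) = (2 * d i).+1) ->
  (forall j, (1 <= j <= t)%N -> size (h j) = (e j).+1) ->
  let Q : int := q%:Z in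
  let herm (k : nat) : int :=
    Q ^+ (4 * k) - (Q ^+ k + 1) * (Q ^+ (2 * k) - Q ^+ k) in
  let eucl (k : nat) : int := Q ^+ (4 * k) - Q ^+ (3 * k) + Q ^+ k in
  #|[set C : {set 'rV[F]_(n + (n + n))} |
      [&& index3_negacirculant C, LCD C & one_generator C]]|%:Z =
  if odd n then
    (Q ^+ 2 - Q + quad_char (-1 : F)) *
      \prod_(2 <= i < s.+1) herm (d i) * \prod_(1 <= j < t.+1) eucl (e j)
  else
    \prod_(1 <= i < s.+1) herm (d i) * \prod_(1 <= j < t.+1) eucl (e j).
Proof.
move=> cardF odd_q n_gt0 co_nq alpha0 ME irr_g irr_h sr_g g1 size_g size_h Q herm eucl.
have two_neq0 : (2%:R : F) != 0.
  by apply: coprime_natr_neq0; rewrite cardF coprime2n.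
rewrite card_LCD_codes //.
set Y := 'X^((2 * n).-1); set M := 'X^n + 1 in ME *.
have sepM : separable_poly M.
  by apply: separable_XnD1 => //; apply: coprime_natr_neq0; rewrite cardF.
(* Each [h j] is kept together with its reciprocal: conjugation exchanges the two, and their product
   is stable, as [unit_pairs_prod] requires. *)
pose r := [seq g i | i <- index_iota 1 s.+1] ++
          [seq h j * reciprocal (h j) | j <- index_iota 1 t.+1].
have rE : M = alpha *: \prod_(p <- r) p by rewrite big_cat !big_map.
have dvd_r p : p \in r -> p %| M.
  by move=> pr; rewrite rE dvdpZr // (big_rem p pr) /= dvdp_mulr.
have gr i : (1 <= i <= s)%N -> g i %| M.
  by move=> i_s; rewrite dvd_r // mem_cat map_f // mem_index_iota ltnS.
have hr j : (1 <= j <= t)%N -> h j * reciprocal (h j) %| M.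
  move=> j_t; rewrite dvd_r // mem_cat.
  by rewrite (map_f (fun j => h j * reciprocal (h j))) ?orbT // mem_index_iota ltnS.
have st_g i : (1 <= i <= s)%N -> g i %| g i \Po Y.
  by move=> i_s; apply: self_reciprocal_comp => //; [exact: gr | exact: sr_g].
have hM j : (1 <= j <= t)%N -> h j %| M.
  by move=> j_t; apply: dvdp_trans (hr j j_t); rewrite dvdp_mulr.
have h'M j : (1 <= j <= t)%N -> reciprocal (h j) %| M.
  by move=> j_t; apply: dvdp_trans (hr j j_t); rewrite dvdp_mull.
have h_h' j : (1 <= j <= t)%N -> h j %| reciprocal (h j) \Po Y.
  by move=> j_t; apply: reciprocal_comp_inv; rewrite // hM.
have h'_h j : (1 <= j <= t)%N -> reciprocal (h j) %| h j \Po Y.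
  by move=> j_t; rewrite -dvdp_reciprocal // h'M.
have unitE : unit_pairs Y n M = (\prod_(p <- r) unit_pairs Y (size p).-1 p)%N.
  rewrite rE unit_pairs_scale // -unit_pairs_prod.
  - by rewrite -(size_scale (\prod_(p <- r) p) alpha0) -rE size_XnD1.
  - by rewrite (eqp_separable (_ : _ %= M)) // rE eqp_sym eqp_scale.
  move=> p; rewrite mem_cat => /orP[] /mapP[i]; rewrite mem_index_iota ltnS => i_s ->.
    exact: st_g.
  by rewrite comp_polyM mulrC dvdp_mul ?h_h' ?h'_h.
have YY : M %| (Y \Po Y) - 'X by apply: comp_Xn_inv_inv.
have hermE i : ((if odd n then 2 else 1) <= i <= s)%N ->
    (unit_pairs Y (size (g i)).-1 (g i))%:Z = herm (d i).
  move=> i_s; have i_s1 : (1 <= i <= s)%N by case: ifP i_s; lia.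
  rewrite size_g //= /herm /Q -cardF; apply: unit_pairs_herm => //.
  - exact: irr_g.
  - exact: size_g.
  - exact: st_g.
  - exact: dvdp_trans (gr i i_s1) YY.
  (* An irreducible polynomial of even degree has size at least 3, so conjugation is nontrivial
     modulo [g i]. *)
  apply/negP => /(inv_fixed_size n_gt0 (gr i i_s1) (irr_g i i_s1)).
  have [] := irr_g i i_s1; rewrite size_g //; lia.
have euclE j : (1 <= j <= t)%N ->
    (unit_pairs Y (size (h j * reciprocal (h j))).-1 (h j * reciprocal (h j)))%:Z =
    eucl (e j).
  move=> j_t; have [irr1 irr2] := irr_h j j_t.
  have sh' : size (reciprocal (h j)) = (e j).+1.
    by rewrite (size_reciprocal n_gt0) ?hM ?size_h.
  rewrite size_mul ?irredp_neq0 // sh' size_h // addSn addnS /= /eucl /Q -cardF.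
  apply: unit_pairs_eucl; rewrite ?size_h ?h_h' ?h'_h ?(dvdp_trans (hr j j_t)) //.
  exact: separable_coprime sepM (hr j j_t).
rewrite unitE big_cat !big_map PoszM.
set Nh := (X in _ * Posz X = _).
have -> : Posz Nh = \prod_(1 <= j < t.+1) eucl (e j).
  rewrite (big_morph Posz PoszM (erefl _)) big_nat [RHS]big_nat.
  by apply: eq_bigr => j; rewrite ltnS => /euclE.
case: ifP => odd_n; rewrite odd_n in hermE; congr (_ * _).
  have [s_gt0 gX1] := g1 odd_n.
  (* For odd [n], the factor of index 1 is ['X + 1], of odd degree, and contributes the term with
     the quadratic character. *)
  rewrite big_ltn ?ltnS // PoszM gX1; congr (_ * _).
    rewrite (_ : size ('X + 1) = 2); last by rewrite -[1]polyC1 size_XaddC.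
    by rewrite /Q -cardF unit_pairs_XD1 // /Y horner_N1_inv.
  rewrite (big_morph Posz PoszM (erefl _)) big_nat [RHS]big_nat.
  by apply: eq_bigr => i; rewrite ltnS => /hermE.
rewrite (big_morph Posz PoszM (erefl _)) big_nat [RHS]big_nat.
by apply: eq_bigr => i; rewrite ltnS => /hermE.
Qed.
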